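(* Let $n\ge 1$ be an integer. The maximum number of crossing tiles in a spherical knot $n$-mosaic (the maximum being taken over all spherical knot $n$-mosaics, of all knots) is $6n^2-3n+1$.
   Context: Mosaic tiles. The tile set is $\mathcal{T}=\{T_0,\dots,T_{10}\}$; each tile is a unit square with arcs joining midpoints of its sides (sides: left L, right R, top U, bottom D): $T_0$ is empty; $T_1,T_2,T_3,T_4$ contain one arc joining respectively L–D, R–D, R–U, L–U; $T_5$ contains the segment L–R; $T_6$ contains the segment U–D; $T_7$ contains two disjoint arcs L–D and R–U; $T_8$ contains two disjoint arcs R–D and L–U; $T_9$ is a crossing of L–R and U–D with L–R over; $T_{10}$ is a crossing of L–R and U–D with U–D over. The crossing tiles are $T_9$ and $T_{10}$. The midpoint of a side of a tile is a connection point if it is an endpoint of an arc on that tile. Spherical mosaics. Let the boundary of the cube $[0,n]^3\subset\mathbb{R}^3$ (a topological $S^2$) have each of its six faces divided into an $n\times n$ grid of unit squares. A spherical $n$-mosaic is a placement of one tile of $\mathcal{T}$ (seen from outside the cube) on each of the $6n^2$ unit squares such that, for each side shared by two unit squares (including sides lying on edges of the cube), its midpoint is a connection point of one tile iff it is a connection point of the other. It is a spherical knot $n$-mosaic if its arcs form a single closed curve (going straight through crossings); it is then a knot diagram on $S^2$ and represents a knot. *)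

(* Defs.v *)
From HB Require Import structures.
From mathcomp Require Import all_boot.

Set Implicit Arguments.
Unset Strict Implicit.
Unset Printing Implicit Defensive.


Inductive side := SideL | SideR | SideU | SideD.

Definition side_code (d : side) : bool * bool :=
  match d with
  | SideL => (false, false)
  | SideR => (false, true)
  | SideU => (true, false)
  | SideD => (true, true)
  end.

Definition side_decode (c : bool * bool) : side :=
  match c with
  | (false, false) => SideL
  | (false, true) => SideR
  | (true, false) => SideU
  | (true, true) => SideD
  end.

Lemma side_codeK : cancel side_code side_decode.
Proof. by case. Qed.

HB.instance Definition _ := Finite.copy side (can_type side_codeK).

Inductive tile := T0 | T1 | T2 | T3 | T4 | T5 | T6 | T7 | T8 | T9 | T10.

(* An arc is given by the two sides whose midpoints it joins. On the crossing
   tiles T9 and T10 the overstrand is listed first. *)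
Definition arcs (t : tile) : seq (side * side) :=
  match t with
  | T0 => [::]
  | T1 => [:: (SideL, SideD)]
  | T2 => [:: (SideR, SideD)]
  | T3 => [:: (SideR, SideU)]
  | T4 => [:: (SideL, SideU)]
  | T5 => [:: (SideL, SideR)]
  | T6 => [:: (SideU, SideD)]
  | T7 => [:: (SideL, SideD); (SideR, SideU)]
  | T8 => [:: (SideR, SideD); (SideL, SideU)]
  | T9 => [:: (SideL, SideR); (SideU, SideD)]
  | T10 => [:: (SideU, SideD); (SideL, SideR)]
  end.

Definition is_crossing (t : tile) : bool :=
  match t with T9 | T10 => true | _ => false end.

Definition connection_point (t : tile) (d : side) : bool :=
  has (fun a => (a.1 == d) || (a.2 == d)) (arcs t).

(* The 6 n^2 unit squares of the boundary of the cube [0,n]^3. The square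
   (k, b, (i, j)) lies on the face where the k-th coordinate is n (b = true)
   or 0 (b = false), in column i and row j of the grid on that face, columns
   being numbered from left to right and rows from bottom to top. *)
Definition square (n : nat) : finType := ('I_3 * bool * ('I_n * 'I_n))%type.

(* The point with k-th coordinate a, (k+1)-st coordinate u and (k+2)-nd
   coordinate v, indices being taken modulo 3. *)
Definition point (k : 'I_3) (a u v : nat) : {ffun 'I_3 -> nat} :=
  [ffun l => if l == k then a else if l == ordS k then u else v].

(* The midpoint in R^3 of side d of the square s, with all coordinates doubled
   so that they are integers. With e_0, e_1, e_2 the standard basis of R^3, a
   face with outward normal e_k has its "right" and "up" directions along
   e_(k+1) and e_(k+2), and one with outward normal - e_k has them along
   e_(k+2) and e_(k+1): (right, up, outward normal) is always a positively
   oriented frame, that is, the tiles are seen from outside the cube. *)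
Definition midpoint (n : nat) (s : square n) (d : side) : {ffun 'I_3 -> nat} :=
  let: (k, b, (i, j)) := s in
  let: (x, y) := match d with
    | SideL => (i.*2, j.*2.+1)
    | SideR => (i.*2.+2, j.*2.+1)
    | SideU => (i.*2.+1, j.*2.+2)
    | SideD => (i.*2.+1, j.*2)
    end in
  if b then point k n.*2 x y else point k 0 y x.

(* Distinct sides of unit squares have distinct midpoints, so equality of
   midpoints says that the two squares share that side. *)
Definition spherical_mosaic (n : nat) (m : square n -> tile) : Prop :=
  forall (s s' : square n) (d d' : side),
    midpoint s d = midpoint s' d' ->
    connection_point (m s) d = connection_point (m s') d'.

(* (s, d, d') stands for the arc of the tile on s joining the sides d and d',
   traversed from d to d'. *)
Definition traversal (n : nat) : finType := (square n * side * side)%type.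

Definition in_mosaic (n : nat) (m : square n -> tile) (a : traversal n) : bool :=
  let: (s, d, d') := a in
  ((d, d') \in arcs (m s)) || ((d', d) \in arcs (m s)).

(* The traversal a leaves its square into that of b, where b starts. *)
Definition followed_by (n : nat) : rel (traversal n) :=
  fun a b =>
    let: (s, _, d) := a in
    let: (s', d', _) := b in
    (s != s') && (midpoint s d == midpoint s' d').

(* Some closed curve runs exactly once along each arc of the mosaic, in one of
   the two directions; as c is nonempty, the mosaic has at least one arc. *)
Definition single_closed_curve (n : nat) (m : square n -> tile) : Prop :=
  exists c : seq (traversal n),
    [/\ c != [::],
        cycle (@followed_by n) c,
        all (in_mosaic m) c
      & forall (s : square n) (d d' : side), (d, d') \in arcs (m s) ->
          count (fun a => (a == (s, d, d')) || (a == (s, d', d))) c = 1].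

Definition spherical_knot_mosaic (n : nat) (m : square n -> tile) : Prop :=
  spherical_mosaic m /\ single_closed_curve m.

Definition num_crossing_tiles (n : nat) (m : square n -> tile) : nat :=
  #|[set s : square n | is_crossing (m s)]|.

(* Main.v *)
Require Import Defs.
From mathcomp Require Import fingroup perm all_boot.

(** Going straight ahead through every square, the connection points of the
cube fall into 3n closed bands of 4n squares each, one around every axis of the
cube at every height.  A square lies on exactly two bands, which are bands
around different axes, and any two bands around different axes cross somewhere.
Regard a non-crossing tile as an edge joining the two bands of its square.

Upper bound.  The curve moves from one band to another only at a non-crossing
tile, so all of it runs along the bands of one connected component of this
graph.  A band in another component meets no arc; hence all its squares are
non-crossing tiles, which join it to every band around another axis, and then
these to every band.  So the graph would be connected after all
([curve_cut]), and a connected graph on 3n vertices has at least 3n - 1 edges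
([cut_card]).  That leaves at most 6n^2 - 3n + 1 crossing tiles.

Construction.  Put crossings everywhere except on the 3n - 1 squares of a
spanning tree of bands, where the crossing is smoothed.  With nothing smoothed
there are 3n components, and smoothing a crossing of two different components
merges them, so one component remains.  To make this precise, orient all bands:
the orientations can be chosen so that every square is traversed from left to
right and from top to bottom.  The tile T7 is then the smoothing compatible
with the orientations everywhere.  The oriented mosaic becomes a permutation of
the pairs (square, direction of entry), smoothing a crossing multiplies this
permutation by a transposition, and the library lemma [porbits_mul_tperm]
counts the cycles. *)

Set Implicit Arguments.
Unset Strict Implicit.
Unset Printing Implicit Defensive.

(** * Counting the edges of a connected multigraph *)

(** A set of vertices grown from a single one, by crossing at each step an edge
of [D] that leaves it, uses a new edge for every new vertex. *)
Lemma cut_card (V E : finType) (f g : E -> V) (D : {set E}) :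
    (forall A : {set V}, A != set0 -> A != [set: V] ->
       exists2 e, e \in D & (f e \in A) != (g e \in A)) ->
  #|V| <= #|D|.+1.
Proof.
move=> cutD.
have grow k : k < #|V| ->
    exists (A : {set V}) (F : {set E}), [/\ F \subset D, #|A| = k.+1, #|F| = k
    & {in F, forall e, (f e \in A) && (g e \in A)}].
  elim: k => [V0 | k IHk ltkV].
    have /card_gt0P[v _] : 0 < #|[set: V]| by rewrite cardsT.
    exists [set v], set0; rewrite sub0set cards1 cards0; split=> // e.
    by rewrite in_set0.
  have [A [F [sFD cA cF FA]]] := IHk (ltnW ltkV).
  have A0 : A != set0 by rewrite -card_gt0 cA.
  have AT : A != [set: V].
    by apply: contraTneq ltkV => AT; rewrite -cardsT -AT cA ltnn.
  have [e De cutAe] := cutD A A0 AT.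
  have eF : e \notin F.
    by apply: contra cutAe => /FA/andP[-> ->].
  have [w [wA feA geA]] : exists w, [/\ w \notin A, f e \in w |: A & g e \in w |: A].
    case feA: (f e \in A) cutAe => /=; case geA: (g e \in A) => //= _.
      by exists (g e); rewrite !inE eqxx feA geA orbT.
    by exists (f e); rewrite !inE eqxx feA geA orbT.
  exists (w |: A), (e |: F); rewrite !cardsU1 wA eF cA cF; split=> //.
    by rewrite subUset sub1set De.
  move=> e' /setU1P[-> | /FA/andP[fA gA]]; first by rewrite feA geA.
  by rewrite !inE fA gA !orbT.
case: (posnP #|V|) => [-> // | V0].
have ltV : #|V|.-1 < #|V| by rewrite prednK.
have [A [F [/subset_leq_card sFD _ cF _]]] := grow _ ltV.
by rewrite -(prednK V0) ltnS -cF.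
Qed.

(** * Bands *)

(** The band of [s] that runs left-right ([h = true]) or up-down: it is given
by the axis that it goes around and its height along that axis. *)
Definition band n (s : square n) (h : bool) : 'I_3 * 'I_n :=
  let: (k, b, (i, j)) := s in
  (if h == b then ordS (ordS k) else ordS k, if h then j else i).

Definition horizontal (d : side) : bool :=
  match d with SideL | SideR => true | SideU | SideD => false end.

Lemma ordS3 (k : 'I_3) : ordS (ordS (ordS k)) = k.
Proof. by apply: val_inj; case: k => -[|[|[|]]]. Qed.

Lemma ordS_neq (k : 'I_3) :
  [/\ (ordS k == k) = false, (ordS (ordS k) == k) = false
    & (ordS (ordS k) == ordS k) = false].
Proof. by case: k => -[|[|[|]]]. Qed.

Lemma ord3P (k l : 'I_3) : [\/ l = k, l = ordS k | l = ordS (ordS k)].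
Proof.
case: k l => -[|[|[|]]] // p [[|[|[|]]]] // q;
  by [constructor 1; apply: val_inj | constructor 2; apply: val_inj
     | constructor 3; apply: val_inj].
Qed.

(** The midpoint of a side has one odd coordinate, and this coordinate alone
determines the band through it: along a band it never changes. *)
Lemma odd_midpoint n (s : square n) d (w := band s (horizontal d)) l :
  odd (midpoint s d l) = (l == w.1) /\ midpoint s d w.1 = w.2.*2.+1.
Proof.
rewrite {}/w; case: s => [[k b] [i j]].
have [k1 k2 k12] := ordS_neq k.
case: (ord3P k l) => ->; case: b d => -[];
  by rewrite /= !ffunE ?(k1, k2, k12, eqxx, odd_double, eq_sym k, eq_sym (ordS k)) /=
     ?odd_double.
Qed.

Lemma midpoint_band n (s s' : square n) d d' :
    midpoint s d = midpoint s' d' ->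
  band s (horizontal d) = band s' (horizontal d').
Proof.
move=> eq_mid.
have [odd1 val1] := odd_midpoint s d (band s (horizontal d)).1.
have [odd2 val2] := odd_midpoint s' d' (band s (horizontal d)).1.
have axis : (band s (horizontal d)).1 = (band s' (horizontal d')).1.
  by apply/eqP; rewrite -odd2 -eq_mid odd1.
have slab : (band s (horizontal d)).2 = (band s' (horizontal d')).2.
  apply/val_inj/double_inj/succn_inj.
  by rewrite -val1 -val2 eq_mid axis.
by rewrite [LHS]surjective_pairing axis slab -surjective_pairing.
Qed.

Lemma bands_meet n (w w' : 'I_3 * 'I_n) : w.1 != w'.1 ->
  exists s h, band s h = w /\ band s (~~ h) = w'.
Proof.
case: w w' => [a u] [a' u'] /=.
case: (ord3P a a') => -> neq; first by rewrite eqxx in neq.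
  by exists (ordS (ordS a), true, (u, u')), false; rewrite /= !ordS3.
by exists (ordS a, true, (u', u)), true; rewrite /= !ordS3.
Qed.

(** * At most 6n^2 - 3n + 1 crossings *)

(** When no non-crossing tile joins a band of [A] to one outside, the curve
cannot pass between [A] and its complement: it keeps its band at a crossing tile,
and also from one square to the next. *)
Lemma curve_side n (m : square n -> tile) (A : {set 'I_3 * 'I_n}) c :
    cycle (@followed_by n) c -> all (in_mosaic m) c ->
    (forall s, ~~ is_crossing (m s) -> (band s true \in A) = (band s false \in A)) ->
  exists beta, {in c, forall a : traversal n, forall d,
    (d == a.1.2) || (d == a.2) -> (band a.1.1 (horizontal d) \in A) = beta}.
Proof.
move=> cyc_c in_c noncut.
have arc_side s d d' : in_mosaic m (s, d, d') ->
    (band s (horizontal d') \in A) = (band s (horizontal d) \in A).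
  move=> in_a; have [cr | /noncut eqA] := boolP (is_crossing (m s)).
    by move: in_a cr; rewrite /in_mosaic; case: (m s) => //; case: d; case: d'.
  by case: (horizontal d); case: (horizontal d').
case: c cyc_c in_c => [|a c] cyc_c in_c; first by exists true.
pose side_of (a : traversal n) := band a.1.1 (horizontal a.1.2) \in A.
have cyc_side : cycle (fun a b => side_of a == side_of b) (a :: c).
  apply: sub_in_cycle cyc_c; last exact: in_c.
  move=> [[s d] d'] [[s' e] e'] /arc_side in_a _ /andP[_ /eqP/midpoint_band mid].
  by rewrite /side_of /= -mid in_a.
have trans_side : transitive (fun a b => side_of a == side_of b).
  by move=> y x z /eqP-> /eqP->.
have /allP side_c := order_path_min trans_side cyc_side.
exists (side_of a) => b bc d; have := side_c b.
rewrite mem_rcons => /(_ bc)/eqP->.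
have := allP in_c b bc; case: b bc => [[s e] e'] _ /arc_side /= in_b.
by case/orP=> /eqP->; rewrite /side_of //= in_b.
Qed.

(** If the cut [A] were crossed by no non-crossing tile, all the arcs would lie
on one side of it, and some band [l] would lie on the other side.  The tiles
along a band without arcs are not crossings, so a band around another axis is on
the same side as [l]; doing this twice reaches every band. *)
Lemma curve_cut n (m : square n -> tile) (A : {set 'I_3 * 'I_n}) :
    single_closed_curve m -> A != set0 -> A != setT ->
  exists2 s, s \in [set s | ~~ is_crossing (m s)]
           & (band s true \in A) != (band s false \in A).
Proof.
case=> c [c0 cyc_c in_c once] A0 AT; apply/exists_inP; apply: contraT.
rewrite negb_exists_in => /forall_inP/= uncut.
have noncut s : ~~ is_crossing (m s) -> (band s true \in A) = (band s false \in A).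
  by move=> ncr; apply/eqP; rewrite -[_ == _]negbK uncut // inE.
have [beta side_c] := curve_side cyc_c in_c noncut.
have side_conn s d : connection_point (m s) d ->
    (band s (horizontal d) \in A) = beta.
  case/hasP=> -[d1 d2] arc /= dE.
  have : has (fun a => (a == (s, d1, d2)) || (a == (s, d2, d1))) c.
    by rewrite has_count once.
  case/hasP=> a ac /orP[] /eqP ea; rewrite ea in ac;
    by apply: (side_c _ ac); rewrite !(eq_sym d) //= orbC.
have off_noncut s h : (band s h \in A) != beta ->
    (band s (~~ h) \in A) = (band s h \in A).
  have [cr | /noncut eqA _] := boolP (is_crossing (m s)); last by case: h.
  have := side_conn s (if h then SideL else SideU).
  by move: cr; case: (m s) => // _; case: h => /= ->; rewrite ?eqxx.
(* [beta] tells on which side of the cut the curve runs. *)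
have [l lA] : exists l, (l \in A) != beta.
  case: beta {side_c side_conn off_noncut}.
    by have /subsetPn[l _ lA] : ~~ (setT \subset A);
      [rewrite subTset | exists l; rewrite (negbTE lA)].
  by have /set0Pn[l lA] := A0; exists l; rewrite lA.
have other x y : (x \in A) != beta -> x.1 != y.1 -> (y \in A) != beta.
  move=> xA /bands_meet[s [h [sx sy]]].
  by rewrite -sy off_noncut sx.
have [k1 k2 k12] := ordS_neq l.1.
have all_off x : (x \in A) != beta.
  have [eq1 | ] := eqVneq l.1 x.1; last exact: other.
  have /other : ((ordS l.1, l.2) \in A) != beta by apply: other lA _; rewrite eq_sym k1.
  by apply; rewrite -eq1 k1.
case: c c0 side_c {cyc_c in_c once} => // -[[s d] d'] c _ side_c.
have := side_c _ (mem_head _ _) d; rewrite /= eqxx => /(_ isT) on_d.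
by have := all_off (band s (horizontal d)); rewrite on_d eqxx.
Qed.

Lemma crossing_tiles_le n (m : square n -> tile) :
  single_closed_curve m -> num_crossing_tiles m <= 6 * n ^ 2 - 3 * n + 1.
Proof.
move=> curve_m.
have := cut_card (fun A A0 AT => curve_cut curve_m A0 AT).
set D := [set s | _]; rewrite card_prod !card_ord => many.
have total : num_crossing_tiles m + #|D| = 6 * n ^ 2.
  have -> : num_crossing_tiles m = #|~: D|.
    by congr #|pred_of_set _|; apply/setP=> s; rewrite !inE negbK.
  by rewrite addnC cardsC !card_prod !card_ord card_bool.
rewrite -(addnK #|D| (num_crossing_tiles m)) total leq_subLR addnC -addnA add1n.
by rewrite addnC -leq_subLR leq_sub2l.
Qed.

(** * The oriented bands *)

Definition entry (h : bool) : side := if h then SideL else SideU.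
Definition exit (h : bool) : side := if h then SideR else SideD.

(** A pair [(s, h)] stands for entering [s] through its left side if [h], through
its top otherwise; [advance] is the next such pair on the same band.  The four
faces around axis a, in the order met, are the positive a+1 face, the positive
a+2 face, the negative a+1 face and the negative a+2 face, and the grids on the
faces are such that each of them is crossed rightwards or downwards.  Where the
band turns neither left nor right in these grids, [ordS i] and [ord_pred j] wrap
around to the column or row where the next face is entered; where it turns, rows
and columns are exchanged. *)
Definition advance n (z : square n * bool) : square n * bool :=
  let: ((k, b, (i, j)), h) := z in
  if h then
    if i.+1 < n then ((k, b, (ordS i, j)), true)
    else if b then ((ordS k, true, (j, i)), false)
    else ((ordS (ordS k), true, (ordS i, j)), true)
  else
    if 0 < j then ((k, b, (i, ord_pred j)), false)
    else if b then ((ordS (ordS k), false, (i, ord_pred j)), false)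
    else ((ordS k, false, (j, i)), true).
Arguments advance : simpl never.

Definition retreat n (z : square n * bool) : square n * bool :=
  let: ((k, b, (i, j)), h) := z in
  if h then
    if 0 < i then ((k, b, (ord_pred i, j)), true)
    else if b then ((ordS k, false, (ord_pred i, j)), true)
    else ((ordS (ordS k), false, (j, i)), false)
  else
    if j.+1 < n then ((k, b, (i, ordS j)), false)
    else if b then ((ordS (ordS k), true, (j, i)), true)
    else ((ordS k, true, (i, ordS j)), false).

Lemma val_ordS n (i : 'I_n) : ordS i = (if i.+1 < n then i.+1 else 0) :> nat.
Proof.
rewrite /=; case: ltnP => [/modn_small // | le_n_i].
have -> : i.+1 = n by apply/eqP; rewrite eqn_leq le_n_i ltn_ord.
exact: modnn.
Qed.

Lemma val_ord_pred n (i : 'I_n) :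
  ord_pred i = (if 0 < i then i.-1 else n.-1) :> nat.
Proof.
rewrite /=; case: i => -[|i] lt_i_n /=.
  by rewrite add0n modn_small // ltn_predL.
by rewrite modnDr modn_small // ltnW.
Qed.

Lemma advanceK n : cancel (@advance n) (@retreat n).
Proof.
case=> [[[k b] [i j]] h]; rewrite /advance.
case: h; case: ifP => edge.
- by rewrite /retreat val_ordS edge ordSK.
- case: b; first by rewrite /retreat edge ordS3.
  by rewrite /retreat val_ordS edge ordS3 ordSK.
- by rewrite /retreat val_ord_pred edge prednK // ltn_ord ord_predK.
- case: b; last by rewrite /retreat edge ordS3.
  rewrite /retreat val_ord_pred edge prednK ?ltnn ?ordS3 ?ord_predK //.
  exact: leq_ltn_trans (ltn_ord j).
Qed.

(** Here the unfolding of the cube behind [advance] is checked against the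
actual positions of the squares in space. *)
Lemma advance_midpoint n (z : square n * bool) :
  let z' := advance z in
  (z.1 != z'.1) && (midpoint z.1 (exit z.2) == midpoint z'.1 (entry z'.2)).
Proof.
case: z => [[[k b] [i j]] h]; rewrite /advance.
have [k1 k2 k12] := ordS_neq k.
have neqs : ((k == ordS k) = false) * ((k == ordS (ordS k)) = false)
    * ((ordS k == ordS (ordS k)) = false).
  by rewrite 2!(eq_sym k) (eq_sym (ordS k)).
have n_gt0 : 0 < n by apply: leq_ltn_trans (ltn_ord i).
have ord_last (l : 'I_n) : (l.+1 < n) = false -> n.*2 = l.*2.+2.
  move/negbT; rewrite -leqNgt -doubleS => le_n_l; congr _.*2; apply/eqP.
  by rewrite eqn_leq le_n_l ltn_ord.
case: h; case: ifP => edge.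
- move: (val_ordS i); rewrite edge; move: (ordS i) => i' ei'.
  rewrite /= !xpair_eqE !eqxx -val_eqE /= ei' (ltn_eqF (ltnSn _)) /=.
  by rewrite doubleS eqxx.
- move: (val_ordS i); rewrite edge; move: (ordS i) (ord_last i edge) => i' en ei'.
  case: b; rewrite /= !xpair_eqE ?neqs /=; apply/eqP/ffunP=> l; rewrite !ffunE ?ordS3;
    by case: (ord3P k l) => ->; rewrite ?(neqs, k1, k2, k12, eqxx) // ?ei' ?en ?doubleS.
- move: (val_ord_pred j); rewrite edge; move: (ord_pred j) => j' ej'.
  rewrite /= !xpair_eqE !eqxx -[j == j']val_eqE /= ej' -doubleS prednK // eqxx.
  by rewrite gtn_eqF // ltn_predL.
- move: (val_ord_pred j); rewrite edge; move: (ord_pred j) => j' ej'.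
  have j0 : j = 0 :> nat by case: posnP edge.
  case: b; rewrite /= !xpair_eqE ?neqs /=; apply/eqP/ffunP=> l; rewrite !ffunE ?ordS3;
    by case: (ord3P k l) => ->; rewrite ?(neqs, k1, k2, k12, eqxx) // ?ej' ?j0 -?doubleS ?prednK.
Qed.

Definition crossing_perm n : {perm square n * bool} := perm (can_inj (@advanceK n)).

(** Smoothing the crossing on [s] exchanges the two ways out of [s], that is,
precomposes the motion with the transposition of the two ways into [s]. *)
Definition smoothed_perm n (S : seq (square n)) : {perm square n * bool} :=
  foldr (fun s p => (tperm (s, true) (s, false) * p)%g) (crossing_perm n) S.

Lemma smoothed_permE n (S : seq (square n)) s h : uniq S ->
  smoothed_perm S (s, h) = advance (s, h (+) (s \in S)).
Proof.
elim: S s h => [|s1 S IHS] s h /=; first by rewrite permE addbF.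
case/andP=> s1S uS; rewrite permM inE.
case: tpermP => [[-> ->] | [-> ->] | ]; rewrite ?IHS //.
- by rewrite eqxx (negbTE s1S).
- by rewrite eqxx (negbTE s1S).
case: eqVneq => [-> | //] h1 h2; by case: h h1 h2.
Qed.

Lemma advance_band n (z : square n * bool) :
  band (advance z).1 (advance z).2 = band z.1 z.2.
Proof.
have /andP[_ /eqP/midpoint_band] := advance_midpoint z.
by case: z => s h; case: (advance _) => s' h'; case: h; case: h'.
Qed.

(** * Merging components *)

(** Smoothing [t] leaves the up-down band of [s] intact. *)
Definition fresh_band n : rel (square n) :=
  fun s t => [forall h, band t h != band s false].

Lemma fresh_bandW n (S : seq (square n)) s : all (fresh_band s) S -> s \notin S.
Proof.
by move=> /allP freshS; apply/negP=> /freshS/forallP/(_ false); rewrite eqxx.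
Qed.

Lemma fresh_band_uniq n (S : seq (square n)) : pairwise (@fresh_band n) S -> uniq S.
Proof. by elim: S => //= s S IHS /andP[/fresh_bandW-> /IHS]. Qed.

(** The motion changes bands only at a smoothed square. *)
Lemma smoothed_orbit_band n (S : seq (square n)) s z :
    uniq S -> all (fresh_band s) S -> z \in porbit (smoothed_perm S) (s, false) ->
  band z.1 z.2 = band s false.
Proof.
move=> uS /allP freshS /porbitP[i ->].
elim: i => [|i IHi]; first by rewrite expg0 perm1.
rewrite expgSr permM; move: IHi; case: ((smoothed_perm S ^+ i)%g _) => t h /= IHi.
rewrite smoothed_permE // advance_band /=.
have [tS | _] := boolP (t \in S); last by rewrite addbF.
by have /forallP/(_ h) := freshS t tS; rewrite IHi eqxx.
Qed.

Lemma band_neq n (s : square n) : band s true != band s false.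
Proof.
case: s => [[k b] [i j]]; have [_ _ k12] := ordS_neq k.
by rewrite /= xpair_eqE; case: b; rewrite /= ?k12 // eq_sym k12.
Qed.

(** When the last square is smoothed, its up-down band is an intact component
and its left-right band belongs to another one, so these two components merge
into one. *)
Lemma card_smoothed_orbits n (S : seq (square n)) : pairwise (@fresh_band n) S ->
  #|porbits (smoothed_perm S)| + size S = #|porbits (crossing_perm n)|.
Proof.
elim: S => [|s S IHS] /=; first by rewrite addn0.
case/andP=> freshS pS; rewrite -(IHS pS).
have := porbits_mul_tperm (smoothed_perm S) (s, true) (s, false).
have -> /= : (s, true) \notin porbit (smoothed_perm S) (s, false).
  apply/negP=> /(smoothed_orbit_band (fresh_band_uniq pS) freshS) /=.
  by apply/eqP/band_neq.
rewrite xpair_eqE eqxx /= addn2 addn1 => -[eqS].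
by rewrite addnS -addSn eqS.
Qed.

(** Every band around axis k+2 goes through the left column of the positive
k face: this gives a starting point in each component. *)
Lemma card_crossing_orbits n : #|porbits (crossing_perm n)| <= 3 * n.
Proof.
case: n => [|n].
  rewrite muln0 leqn0 cards_eq0; apply/eqP/setP=> C; rewrite inE.
  by apply/imsetP=> -[[[? [[]]]]].
pose orb z := porbit (crossing_perm n.+1) z.
have orb_advance z : orb (advance z) = orb z.
  by rewrite /orb -[RHS](porbit_perm _ 1) expg1 permE.
have orb_row k b i j : orb ((k, b, (i, j)), true) = orb ((k, b, (ord0, j)), true).
  case: i => i; elim: i => [|i IHi] lt_i; first by congr (orb (_, (_, _), _)); apply: val_inj.
  rewrite -(IHi (ltnW lt_i)) -[RHS]orb_advance /advance /= lt_i.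
  by congr (orb (_, (_, _), _)); apply: val_inj; rewrite /= modn_small.
have orb_col k b i j : orb ((k, b, (i, j)), false) = orb ((k, b, (i, ord0)), false).
  case: j => j; elim: j => [|j IHj] lt_j; first by congr (orb (_, (_, _), _)); apply: val_inj.
  rewrite -(IHj (ltnW lt_j)) -orb_advance /advance /=.
  congr (orb (_, (_, _), _)); apply: val_inj; rewrite /= modnDr.
  by rewrite modn_small // ltnW.
have orb_rowF k j : orb ((k, false, (ord0, j)), true)
    = orb ((ordS (ordS k), true, (ord0, j)), true).
  rewrite -(orb_row _ _ ord_max) -orb_advance /advance /= ltnn.
  exact: orb_row.
have orb_colT k i : orb ((ordS k, true, (i, ord0)), false)
    = orb ((k, true, (ord0, i)), true).
  rewrite -[RHS](orb_row _ _ ord_max) -[RHS]orb_advance /advance /= ltnn.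
  by rewrite [RHS]orb_col.
have orb_colF k i : orb ((k, false, (i, ord0)), false)
    = orb ((ordS k, false, (ord0, i)), true).
  by rewrite -orb_advance /advance.
pose rep (w : 'I_3 * 'I_n.+1) := orb ((w.1, true, (ord0, w.2)), true).
have -> : 3 * n.+1 = #|{: 'I_3 * 'I_n.+1}| by rewrite card_prod !card_ord.
apply: leq_trans (leq_imset_card rep _); apply/subset_leq_card/subsetP=> _ /imsetP[z _ ->].
have rep_im k j : orb ((k, true, (ord0, j)), true) \in rep @: {: 'I_3 * 'I_n.+1}.
  by apply/imsetP; exists (k, j).
case: z => [[[k []] [i j]] []]; rewrite -[porbit _ _]/(orb _).
- by rewrite orb_row.
- by rewrite orb_col -(ordS3 k) orb_colT.
- by rewrite orb_row orb_rowF.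
- by rewrite orb_col orb_colF orb_rowF.
Qed.

(** * The mosaic of a list of smoothed squares *)

Definition smoothed_tiles n (S : seq (square n)) (s : square n) : tile :=
  if s \in S then T7 else T9.

Definition strand n (S : seq (square n)) (z : square n * bool) : traversal n :=
  (z.1, entry z.2, exit (z.2 (+) (z.1 \in S))).

Lemma smoothed_tiles_spherical n (S : seq (square n)) :
  spherical_mosaic (smoothed_tiles S).
Proof.
have conn s d : connection_point (smoothed_tiles S s) d.
  by rewrite /smoothed_tiles; case: ifP; case: d.
by move=> s s' d d' _; rewrite !conn.
Qed.

Lemma strand_arc n (S : seq (square n)) z : in_mosaic (smoothed_tiles S) (strand S z).
Proof.
by case: z => s h; rewrite /strand /smoothed_tiles /=; case: ifP; case: h.
Qed.

Lemma arc_strand n (S : seq (square n)) s d d' : (d, d') \in arcs (smoothed_tiles S s) ->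
  exists h, forall z,
    ((strand S z == (s, d, d')) || (strand S z == (s, d', d))) = (z == (s, h)).
Proof.
rewrite /smoothed_tiles => arc; exists (if s \in S then d == SideL else horizontal d) => -[t h].
rewrite /strand !xpair_eqE /=; case: eqVneq => [-> | //]; move: arc; case: ifP => _;
  by case: d; case: d' => //; case: h.
Qed.

(** The single cycle of the permutation visits every pair [(s, h)] once, hence
every arc once, as each arc is the strand of exactly one pair ([arc_strand]). *)
Lemma smoothed_tiles_curve n (S : seq (square n)) : 0 < n -> uniq S ->
  #|porbits (smoothed_perm S)| = 1 -> single_closed_curve (smoothed_tiles S).
Proof.
move=> n0 uS /eqP/cards1P[C orbC].
pose p := smoothed_perm S; pose o : 'I_n := Ordinal n0.
pose z0 : square n * bool := ((ord0, true, (o, o)), true).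
have all_orbit z : z \in orbit p z0.
  have same x : porbit p x = C.
    by apply/set1P; rewrite -orbC; apply/imsetP; exists x.
  have : z \in porbit p z0 by rewrite same -(same z) porbit_id.
  by case/porbitP=> i ->; rewrite permX -fconnect_orbit fconnect_iter.
exists (map (strand S) (orbit p z0)); split.
- by rewrite -size_eq0 size_map size_orbit -lt0n order_gt0.
- rewrite cycle_map; apply: sub_cycle (cycle_orbit perm_inj z0) => -[s h] _ /eqP<- /=.
  rewrite smoothed_permE // /strand /=.
  by have := advance_midpoint (s, h (+) (s \in S)).
- by rewrite all_map; apply/allP=> z _; apply: strand_arc.
move=> s d d' /arc_strand[h arcE].
rewrite count_map (eq_count arcE) -[LHS]/(count_mem _ _).
by rewrite count_uniq_mem ?orbit_uniq // all_orbit.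
Qed.

(** * A spanning tree of bands *)

(** The square of height [v] in the bottom row of the positive [k] face joins the
band of height [v] around axis k+1 to the band of height 0 around axis k+2. *)
Definition bottom_square n (k : 'I_3) (v : 'I_n.+1) : square n.+1 := (k, true, (v, ord0)).

(** The root is the band of height 0 around axis 0.  The bands around axis 2 are
attached to the root, those around axis 1 to the band of height 0 around axis 2,
and the other bands around axis 0 to the band of height 0 around axis 1.  Smoothed
squares are pushed at the front of the list, so this order is reversed. *)
Definition tree_squares n : seq (square n.+1) :=
  [seq bottom_square (ordS (ordS ord0)) (lift ord0 v) | v <- enum 'I_n]
    ++ [seq bottom_square ord0 v | v <- enum 'I_n.+1]
    ++ [seq bottom_square (ordS ord0) v | v <- enum 'I_n.+1].

Lemma size_tree_squares n : size (tree_squares n) = 3 * n + 2.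
Proof.
rewrite !size_cat 3!size_map -!cardE !card_ord !mulSn.
by rewrite addn0 addSn !addnS addn0.
Qed.

Lemma fresh_band_bottom n k k' (v v' : 'I_n.+1) :
  fresh_band (bottom_square k v) (bottom_square k' v')
    = ((k', v') != (k, v)) && ((ordS k', ord0) != (k, v)).
Proof.
have inj3 : injective (@ordS 3) := can_inj (@ordSK 3).
apply/forallP/andP=> [fresh | [new_h new_v] [|]].
- by have := fresh false; have := fresh true; rewrite /= !xpair_eqE !(inj_eq inj3).
- by move: new_v; rewrite /= !xpair_eqE !(inj_eq inj3).
- by move: new_h; rewrite /= !xpair_eqE !(inj_eq inj3).
Qed.

Lemma tree_squares_fresh n : pairwise (@fresh_band n.+1) (tree_squares n).
Proof.
have pairwise_bottom m k (f : 'I_m -> 'I_n.+1) : injective f ->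
    pairwise (@fresh_band n.+1) [seq bottom_square k (f v) | v <- enum 'I_m].
  move=> inj_f; rewrite pairwise_map.
  apply: sub_pairwise (_ : pairwise (fun u v => u != v) (enum 'I_m)).
    move=> u v neq_uv; rewrite /= fresh_band_bottom !xpair_eqE eqxx inj_eq // eq_sym neq_uv.
    by have [-> _ _] := ordS_neq k.
  by rewrite -uniq_pairwise enum_uniq.
rewrite !pairwise_cat !pairwise_bottom ?allrel_catr //; last exact: lift_inj.
rewrite !andbT -andbA; apply/and3P; split; apply/allrelP=> _ _ /mapP[u _ ->] /mapP[v _ ->];
  by rewrite fresh_band_bottom !xpair_eqE.
Qed.

Theorem theorem5p6 (n : nat) (hn : 1 <= n) :
  (exists m : square n -> tile,
     spherical_knot_mosaic m /\
     num_crossing_tiles m = 6 * n ^ 2 - 3 * n + 1) /\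
  (forall m : square n -> tile,
     spherical_knot_mosaic m ->
     num_crossing_tiles m <= 6 * n ^ 2 - 3 * n + 1).
Proof.
split; last by move=> m [_]; apply: crossing_tiles_le.
case: n hn => // n n1.
have uniq_tree := fresh_band_uniq (tree_squares_fresh n).
have curve : single_closed_curve (smoothed_tiles (tree_squares n)).
  apply: smoothed_tiles_curve => //; apply/eqP; rewrite eqn_leq; apply/andP; split.
    rewrite -(leq_add2r (size (tree_squares n))) (card_smoothed_orbits (tree_squares_fresh n)).
    apply: leq_trans (card_crossing_orbits _) _.
    by rewrite size_tree_squares mulnS addnC addnCA.
  apply/card_gt0P; exists (porbit (smoothed_perm (tree_squares n)) ((ord0, true, (ord0, ord0)), true)).
  exact: imset_f.
exists (smoothed_tiles (tree_squares n)); split; first by split=> //; apply: smoothed_tiles_spherical.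
have -> : num_crossing_tiles (smoothed_tiles (tree_squares n)) = #|[predC tree_squares n]|.
  by rewrite /num_crossing_tiles cardsE; apply: eq_card => s;
    rewrite !inE unfold_in /smoothed_tiles; case: ifP.
rewrite -(addKn #|tree_squares n| #|[predC _]|) cardC !card_prod !card_ord card_bool.
rewrite (card_uniqP uniq_tree) size_tree_squares -[n.+1 * n.+1]/(n.+1 ^ 2).
have -> : 3 * n.+1 = (3 * n + 2).+1 by rewrite mulnS addnC addnS.
have lt_tree : 3 * n + 2 < 6 * n.+1 ^ 2.
  have: 3 * n + 2 < 3 * n.+1 by rewrite mulnS addnC ltn_add2r.
  by move/leq_trans; apply; rewrite leq_mul // leq_pmulr.
by rewrite subnS addn1 prednK // subn_gt0.
Qed.
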